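(* Let $L$ be a finite-dimensional Leibniz algebra over a field $F$. Suppose that $L=E\oplus Z$ (algebra direct sum), where $Z$ is a central ideal of $L$ and $E$ is an extraspecial Leibniz algebra such that $J=\{x\in L\mid x^2=0\}$ is an abelian ideal of $L$. Then $L$ is modular.
   Context: A (right) Leibniz algebra over a field $F$ is an $F$-vector space $L$ with a bilinear product $[\cdot,\cdot]$ satisfying $[x,[y,z]]=[[x,y],z]-[[x,z],y]$ for all $x,y,z\in L$; write $x^2=[x,x]$. The centre of a Leibniz algebra $A$ is $Z(A)=\{z\in A\mid [z,x]=[x,z]=0\text{ for all }x\in A\}$; a central ideal is one contained in the centre. A Leibniz algebra $E$ is extraspecial if $\dim Z(E)=1$ and $E/Z(E)$ is abelian (all products zero). $\langle\cdot,\cdot\rangle$ denotes the subalgebra generated. A subalgebra $U$ of $L$ is modular in $L$ if both: (1) $\langle U,V\rangle\cap W=\langle V,U\cap W\rangle$ for all subalgebras $V\subseteq W$ of $L$; (2) $\langle U,V\rangle\cap W=\langle V\cap W,U\rangle$ for all subalgebras $V,W$ of $L$ with $U\subseteq W$. $L$ is modular if every subalgebra of $L$ is modular in $L$. *)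

(* Defs.v *)
From HB Require Import structures.
From mathcomp Require Import all_boot all_algebra.

Set Implicit Arguments.
Unset Strict Implicit.
Unset Printing Implicit Defensive.

Import GRing.Theory.
Local Open Scope ring_scope.

HB.mixin Record isLeibniz (F : fieldType) L of GRing.Lmodule F L := {
  bracket : L -> L -> L;
  bracket_bilinear : bilinear_for *:%R *:%R bracket;
  bracket_leibniz : forall x y z : L,
    bracket x (bracket y z) = bracket (bracket x y) z - bracket (bracket x z) y
}.

#[short(type="leibnizVectType")]
HB.structure Definition LeibnizVect (F : fieldType) :=
  {L of Vector F L & isLeibniz F L}.

(* In the finite-dimensional setting of [vectType], the subspaces of L are the
   elements of {vspace L}; subalgebras and ideals are subspaces of L. *)
Section LeibnizTheory.
Variables (F : fieldType) (L : leibnizVectType F).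
Implicit Types (x y z : L) (A U V W E Z I : {vspace L}) (S : {pred L}).

HB.instance Definition _ x :=
  GRing.isLinear.Build F L L *:%R (bracket x) (bracket_bilinear.2 x).

Definition bracketr y x : L := bracket x y.

HB.instance Definition _ y :=
  GRing.isLinear.Build F L L *:%R (bracketr y) (bracket_bilinear.1 y).

Definition subalgebra A : Prop := {in A &, forall x y, bracket x y \in A}.

(* Two-sided ideals of the whole of L, for an arbitrary subset S. *)
Definition ideal S : Prop :=
  submod_closed S /\
  (forall x y, y \in S -> (bracket x y \in S) && (bracket y x \in S)).

Definition abelian S : Prop := {in S &, forall x y, bracket x y = 0}.

(* The centre of A as an algebra in its own right; see [centreP]. *)
Definition centre A : {vspace L} :=
  (A :&: \bigcap_(i < \dim A)
     (lker (linfun (bracket (vbasis A)`_i)) :&: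
      lker (linfun (bracketr (vbasis A)`_i))))%VS.

Lemma centreP A z :
  reflect (z \in A /\ {in A, forall x, bracket z x = 0 /\ bracket x z = 0})
          (z \in centre A).
Proof.
rewrite memv_cap; apply: (iffP andP) => -[zA zC]; split=> //.
  have zb i : (i < \dim A)%N ->
      bracket (vbasis A)`_i z = 0 /\ bracketr (vbasis A)`_i z = 0.
    move=> ltiA; move/subv_bigcapP/(_ (Ordinal ltiA) isT): zC.
    by rewrite -memvE memv_cap !memv_ker !lfunE => /andP[/eqP-> /eqP->].
  move=> x xA; rewrite (coord_vbasis xA) -[bracket z _]/(bracketr _ z).
  rewrite -[bracket _ z]/(bracketr z _) /bracketr !linear_sum.
  rewrite -[X in _ /\ X = _]/(bracketr z _) linear_sum.
  split; apply: big1 => i _; rewrite linearZ /=.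
    by rewrite [bracket z _](zb i (ltn_ord i)).2 scaler0.
  by rewrite [bracketr z _](zb i (ltn_ord i)).1 scaler0.
rewrite memvE; apply/subv_bigcapP => i _; rewrite -memvE memv_cap !memv_ker !lfunE.
have /zC[z1 z2]: (vbasis A)`_i \in A by rewrite vbasis_mem ?mem_nth ?size_tuple.
by rewrite /= /bracketr z1 z2 !eqxx.
Qed.

Definition central_ideal Z : Prop := ideal Z /\ (Z <= centre fullv)%VS.

(* A/I is abelian: the product of the cosets x + I and y + I, that is
   bracket x y + I, is the zero coset I. *)
Definition abelian_quotient A I : Prop :=
  {in A &, forall x y, bracket x y \in I}.

Definition extraspecial E : Prop :=
  [/\ subalgebra E, \dim (centre E) = 1%N & abelian_quotient E (centre E)].

Definition algebra_direct_sum E Z : Prop :=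
  [/\ ideal E, ideal Z, directv (E + Z) & (E + Z = fullv)%VS].

Definition square_zero : {pred L} := [pred x | bracket x x == 0].

(* Membership in <U, V>, the smallest subalgebra containing U and V. *)
Definition in_gen U V x : Prop :=
  forall A, subalgebra A -> (U <= A)%VS -> (V <= A)%VS -> x \in A.

Definition modular_in U : Prop :=
  (forall V W, subalgebra V -> subalgebra W -> (V <= W)%VS ->
     forall x, in_gen U V x /\ x \in W <-> in_gen V (U :&: W) x) /\
  (forall V W, subalgebra V -> subalgebra W -> (U <= W)%VS ->
     forall x, in_gen U V x /\ x \in W <-> in_gen (V :&: W) U x).

End LeibnizTheory.

Arguments square_zero {F} L.

Definition modular (F : fieldType) (L : leibnizVectType F) : Prop :=
  forall U : {vspace L}, subalgebra U -> modular_in U.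

(* Main.v *)
Require Import Defs.
From HB Require Import structures.
From mathcomp Require Import all_boot all_algebra.

(** In L every product lies in the line C = Z(E), because E/C is abelian and Z
    is central. So a subalgebra U either contains C or consists of square-zero
    elements: a nonzero square of an element of U would span C inside U.
    Conversely every subspace containing C is a subalgebra, and so is every
    subspace of the abelian ideal J of square-zero elements
    ([subalgebra_add_line]). Both kinds of subspace are stable under sums: a sum
    with one summand containing C contains C, and a sum of two subspaces of J
    lies in J. Hence the sum of two subalgebras is always a subalgebra, so the
    subalgebra generated by U and V is U + V. Both modularity conditions then
    become Dedekind's modular law for subspaces ([modular_of_subalgebra_add]). *)

Import GRing.Theory.
Local Open Scope ring_scope.

Section SumsOfSubalgebras.
Variables (F : fieldType) (L : leibnizVectType F).
Implicit Types (x y z : L) (C E U V W Z : {vspace L}).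

Lemma bracketDl x1 x2 y : bracket (x1 + x2) y = bracket x1 y + bracket x2 y.
Proof. exact: (linearD (bracketr y)). Qed.

Lemma bracketDr x y1 y2 : bracket x (y1 + y2) = bracket x y1 + bracket x y2.
Proof. exact: linearD. Qed.

Lemma subalgebra_cap U V :
  subalgebra U -> subalgebra V -> subalgebra (U :&: V)%VS.
Proof.
move=> sU sV x y; rewrite !memv_cap => /andP[xU xV] /andP[yU yV].
by rewrite sU // sV.
Qed.

Lemma in_genP U V x :
  subalgebra (U + V)%VS -> reflect (in_gen U V x) (x \in (U + V)%VS).
Proof.
move=> sUV; apply: (iffP idP) => [xUV A _ UA VA | genx].
  by apply: subvP xUV; rewrite subv_add UA.
by apply: genx => //; [apply: addvSl | apply: addvSr].
Qed.

Lemma modular_of_subalgebra_add :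
  (forall U V, subalgebra U -> subalgebra V -> subalgebra (U + V)%VS) ->
  modular L.
Proof.
move=> sadd U sU; split=> V W sV sW sub x.
  have genUV := in_genP U V x (sadd _ _ sU sV).
  have genVUW := in_genP V (U :&: W)%VS x (sadd _ _ sV (subalgebra_cap _ _ sU sW)).
  split=> [[/genUV xUV xW] | /genVUW].
    by apply/genVUW; rewrite (vspace_modl U sub) memv_cap addvC xUV.
  by rewrite (vspace_modl U sub) memv_cap addvC => /andP[/genUV].
have genUV := in_genP U V x (sadd _ _ sU sV).
have genVWU := in_genP (V :&: W)%VS U x (sadd _ _ (subalgebra_cap _ _ sV sW) sU).
split=> [[/genUV xUV xW] | /genVWU].
  by apply/genVWU; rewrite addvC (vspace_modl V sub) memv_cap xUV.
by rewrite addvC (vspace_modl V sub) memv_cap => /andP[/genUV].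
Qed.

(** A nonzero square in U is a nonzero vector of the line C, so C meets U
    nontrivially and is therefore contained in it. *)
Lemma subalgebra_line_or_square_zero C U :
  \dim C = 1%N -> (forall x y, bracket x y \in C) -> subalgebra U ->
  (C <= U)%VS \/ {subset U <= square_zero L}.
Proof.
move=> dimC brC sU; case: (boolP (C <= U)%VS) => [|nCU]; [by left | right].
move=> x xU; rewrite inE; apply: contraNT nCU => nz_xx.
suff <- : <[bracket x x]>%VS = C by rewrite -memvE sU.
by apply/eqP; rewrite eqEdim -memvE brC dimC dim_vline nz_xx.
Qed.

Lemma subalgebra_add_line C :
  \dim C = 1%N -> (forall x y, bracket x y \in C) ->
  submod_closed (square_zero L) -> abelian (square_zero L) ->
  forall U V, subalgebra U -> subalgebra V -> subalgebra (U + V)%VS.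
Proof.
move=> dimC brC [_ Jlin] Jab U V sU sV.
have above W : (C <= W)%VS -> subalgebra W.
  by move=> CW x y _ _; apply: subvP (brC x y).
have [CU | UJ] := subalgebra_line_or_square_zero _ _ dimC brC sU.
  by apply: above; apply: subv_trans CU (addvSl _ _).
have [CV | VJ] := subalgebra_line_or_square_zero _ _ dimC brC sV.
  by apply: above; apply: subv_trans CV (addvSr _ _).
have UVJ : {subset (U + V)%VS <= square_zero L}.
  move=> _ /memv_addP[u uU [v vV ->]].
  by rewrite -[u]scale1r; apply: Jlin; [apply: UJ | apply: VJ].
by move=> x y /UVJ xJ /UVJ yJ; rewrite Jab // mem0v.
Qed.

(** The Z-components of x and y contribute nothing to their product, so
    [x, y] = [e, e'] for the E-components e and e', and this lies in C because
    E/C is abelian. *)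
Lemma bracket_add_central E Z C :
  (E + Z = fullv)%VS -> (Z <= centre (fullv : {vspace L}))%VS ->
  abelian_quotient E C -> forall x y, bracket x y \in C.
Proof.
move=> EZ Zc EC x y.
have decomp w : exists2 e, e \in E & exists2 z, z \in Z & w = e + z.
  by apply/memv_addP; rewrite EZ memvf.
have Z0 z w : z \in Z -> bracket z w = 0 /\ bracket w z = 0.
  by move=> /(subvP Zc)/centreP[_]; apply; apply: memvf.
have [e eE [z zZ ->]] := decomp x; have [e' e'E [z' z'Z ->]] := decomp y.
rewrite bracketDl (Z0 z _ zZ).1 addr0 bracketDr (Z0 z' _ z'Z).2 addr0.
exact: EC.
Qed.

End SumsOfSubalgebras.

Theorem corollary6p5 (F : fieldType) (L : leibnizVectType F)
  (E Z : {vspace L})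
  (LEZ : algebra_direct_sum E Z)
  (Zcentral : central_ideal Z)
  (Eextra : extraspecial E)
  (Jideal : ideal (square_zero L))
  (Jabelian : abelian (square_zero L)) :
  modular L.
Proof.
have [_ _ _ EZ] := LEZ; have [_ Zc] := Zcentral.
have [_ dimC EC] := Eextra; have [Jsub _] := Jideal.
apply: modular_of_subalgebra_add.
apply: (subalgebra_add_line _ _ (centre E)) => //.
exact: bracket_add_central EZ Zc EC.
Qed.
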